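(* Let $I$ be a finite set with $n := \#I \in \mathbb{N}_0$, let $g : \{0,1,\ldots,n\} \to \mathbb{R}$ be a function, let $r \in \mathbb{N}_0$, and let $c = (c_1,\ldots,c_r) \in \mathbb{R}^r$ be such that $$D := \big\{ p \in [0,1]^I : \kappa_\ell(\mathrm{BC}_p) = c_\ell \text{ for all } \ell \in \{1,\ldots,r\} \big\} \neq \emptyset .$$ Then $\max_{p \in D} \mathrm{BC}_p\, g$ (exists and) is attained at some $p \in D$ with $$r' := \#\big(\{p_i : i \in I\} \setminus \{0,1\}\big) \le r .$$ For such a $p$, we have $$\mathrm{BC}_p = \delta_{n_0} \ast \mathop{\ast}_{j=1}^{r'} \mathrm{B}_{n_j,q_j},$$ where $q_1,\ldots,q_{r'}$ is an enumeration of the $r'$ distinct elements of $\{p_i : i\in I\}\setminus\{0,1\}$, $q_0 := 1$, and $n_j := \#\{i \in I : p_i = q_j\}$ for $j \in \{0,1,\ldots,r'\}$.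
   Context: $\mathbb{N}_0 = \{0,1,2,\ldots\}$; $\#A$ is the number of elements of a set $A$. In particular $\{p_i : i\in I\}$ is a set, so $\#(\{p_i : i\in I\}\setminus\{0,1\})$ counts distinct values. For $r=0$ there are no constraints, so $D=[0,1]^I$. $\ast$ denotes convolution of probability measures on $\mathbb{R}$; an empty convolution is the Dirac measure $\delta_0$. $\delta_a$ is the Dirac measure at $a\in\mathbb{R}$. For $p \in [0,1]$, $\mathrm{B}_p := (1-p)\delta_0 + p\,\delta_1$ is the Bernoulli law, and for $m\in\mathbb{N}_0$, $\mathrm{B}_{m,p} := \mathrm{B}_p^{\ast m}$ is the binomial law. For a finite set $I$ and $p = (p_i)_{i\in I} \in [0,1]^I$, the Bernoulli convolution is $\mathrm{BC}_p := \ast_{i \in I} \mathrm{B}_{p_i}$; it is concentrated on $\{0,1,\ldots,\#I\}$. For a probability measure $P$ and a $P$-integrable function $g$, $Pg := \int g\,\mathrm{d}P$; thus $\mathrm{BC}_p\,g = \sum_{k=0}^n g(k)\,\mathrm{BC}_p(\{k\})$. For an integer $\ell\ge 1$ and a probability measure $P$ on $\mathbb{R}$ with $\int |x|^\ell\,\mathrm{d}P(x)<\infty$, the $\ell$-th cumulant is $$\kappa_\ell(P) := \mathrm{i}^{-\ell}\Big(\frac{\mathrm{d}}{\mathrm{d}t}\Big)^{\ell} \log\Big(\int e^{\mathrm{i}tx}\,\mathrm{d}P(x)\Big)\Big|_{t=0},$$ where $\mathrm{i}$ is the imaginary unit. *)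

(* Defs.v *)
From HB Require Import structures.
From mathcomp Require Import all_boot all_order all_algebra.
From mathcomp Require Import finmap.
From mathcomp Require Import all_classical all_reals all_analysis.
From mathcomp Require Import complex.

Set Implicit Arguments.
Unset Strict Implicit.
Unset Printing Implicit Defensive.

Import Order.TTheory GRing.Theory Num.Theory.
Import numFieldNormedType.Exports.

Local Open Scope classical_set_scope.
Local Open Scope ring_scope.

Notation realProb R := (probability (measurableTypeR R) R).

Section convolution.
Context {R : realType}.
Notation RR := (measurableTypeR R).

Definition add_pair (z : RR * RR) : RR := z.1 + z.2.

Fact measurable_add_pair : measurable_fun setT add_pair.
Proof. exact: measurable_realfun.measurable_funD. Qed.

HB.instance Definition _ :=
  isMeasurableFun.Build _ _ _ _ add_pair measurable_add_pair.

(* The law of X + Y for independent X ~ P and Y ~ Q. *)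
Definition convolution (P Q : realProb R) : realProb R :=
  distribution (P \x Q)%E add_pair.

Definition delta (a : R) : realProb R := \d_(a : RR).

End convolution.

Section bernoulli.
Context {R : realType} (p : R).
Local Open Scope ereal_scope.
Notation RR := (measurableTypeR R).

(* As for the library's [bernoulli_prob], the value outside 0 <= p <= 1 is a
   dummy that only makes the function total. *)
Definition bernoulli_law (A : set RR) : \bar R :=
  if (0 <= p <= 1)%R
  then (1 - p)%:E * \d_(0%R : RR) A + p%:E * \d_(1%R : RR) A
  else \d_(0%R : RR) A.

Fact bernoulli_lawE :
  exists m : {measure set RR -> \bar R}, bernoulli_law = m.
Proof.
have [/andP[p0 p1]|p01] := boolP (0 <= p <= 1)%R; last first.
  by exists \d_(0%R : RR); apply/funext => A; rewrite /bernoulli_law ifN.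
have q0 : (0 <= 1 - p)%R by rewrite subr_ge0.
exists (measure_add (mscale (NngNum q0) \d_(0%R : RR))
                    (mscale (NngNum p0) \d_(1%R : RR))).
by apply/funext => A; rewrite /bernoulli_law p0 p1; exact/esym/measure_addE.
Qed.

Fact bernoulli_law0 : bernoulli_law set0 = 0.
Proof. by have [m ->] := bernoulli_lawE. Qed.

Fact bernoulli_law_ge0 A : 0 <= bernoulli_law A.
Proof. by have [m ->] := bernoulli_lawE. Qed.

Fact bernoulli_law_sigma_additive : semi_sigma_additive bernoulli_law.
Proof.
by have [m ->] := bernoulli_lawE; exact: measure_semi_sigma_additive.
Qed.

HB.instance Definition _ := isMeasure.Build _ _ _ bernoulli_law
  bernoulli_law0 bernoulli_law_ge0 bernoulli_law_sigma_additive.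

Fact bernoulli_law_setT : bernoulli_law setT = 1.
Proof.
rewrite /bernoulli_law !diracT !mule1; case: ifP => // _.
by rewrite -EFinD subrK.
Qed.

HB.instance Definition _ :=
  Measure_isProbability.Build _ _ _ bernoulli_law bernoulli_law_setT.

End bernoulli.

Section bernoulli_convolution.
Context {R : realType}.

Definition bernoulliR (p : R) : realProb R := bernoulli_law p.

Definition binomialR (m : nat) (p : R) : realProb R :=
  \big[convolution/delta 0]_(j < m) bernoulliR p.

Definition BC (I : finType) (p : I -> R) : realProb R :=
  \big[convolution/delta 0]_(i : I) bernoulliR (p i).

(* A function on {0, ..., n}, extended by 0 to the real line, so that it can be
   integrated against a law on the real line. *)
Definition extend0 (n : nat) (g : 'I_n.+1 -> R) (x : R) : R :=
  \sum_(k < n.+1) g k * \1_[set k%:R] x.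

Definition expect (P : realProb R) (n : nat) (g : 'I_n.+1 -> R) : R :=
  \int[P]_x extend0 g x.

End bernoulli_convolution.

Section cumulants.
Import Normc.
Context {R : realType}.
Local Open Scope complex_scope.

(* exp(itx) = cos(tx) + i sin(tx), integrated componentwise. *)
Definition char_fun (P : realProb R) (t : R) : R[i] :=
  (\int[P]_x cos (t * x)) +i* (\int[P]_x sin (t * x)).

(* Principal values: the argument is in ]-pi, pi] when z <> 0. *)
Definition carg (z : R[i]) : R :=
  let theta := acos (complex.Re z / normc z) in
  if 0 <= complex.Im z then theta else - theta.

Definition clog (z : R[i]) : R[i] := ln (normc z) +i* carg z.

(* Derivatives of complex-valued functions of a real variable are taken
   componentwise. *)
Definition cderive (l : nat) (f : R -> R[i]) (t : R) : R[i] :=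
  (derive1n l (fun s => complex.Re (f s)) t)
    +i* (derive1n l (fun s => complex.Im (f s)) t).

Definition cumulant (l : nat) (P : realProb R) : R[i] :=
  (0 +i* 1) ^- l * cderive l (fun t => clog (char_fun P t)) 0.

End cumulants.

Section constraints.
Context {R : realType} {I : finType}.

(* c j is the prescribed value of the cumulant of order j + 1. *)
Definition feasible (r : nat) (c : 'I_r -> R) : set (I -> R) :=
  [set p | (forall i, 0 <= p i <= 1) /\
           (forall j : 'I_r, cumulant j.+1 (BC p) = ((c j)%:C)%C)].

Definition inner_values (p : I -> R) : set R := range p `\` [set 0; 1].

Definition num_inner (p : I -> R) : nat := #|` fset_set (inner_values p)|%fset.

Definition multiplicity (p : I -> R) (x : R) : nat := #|[pred i | p i == x]|.

Definition maximizer (r : nat) (c : 'I_r -> R) (g : 'I_#|I|.+1 -> R)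
    (p : I -> R) : Prop :=
  feasible c p /\
  forall p', feasible c p' -> expect (BC p') g <= expect (BC p) g.

End constraints.

(* Main.v *)
Require Import Defs.
From HB Require Import structures.
From mathcomp Require Import all_boot all_order all_algebra.
From mathcomp Require Import finmap.
From mathcomp Require Import all_classical all_reals all_analysis.
From mathcomp Require Import measurable_realfun polyrcf complex ring lra zify.

(** The law BC_p is determined by its generating function, the polynomial
    [prod_i (1 + p_i (X - 1))], which is the polynomial [prod_i (1 + p_i X)]
    with [X - 1] substituted for [X].  The decomposition into binomial laws is
    therefore a rearrangement of a product of polynomials
    ([BC_binomial_decomposition]), and [BC_p g] is a linear form in
    [prod_i (1 + p_i X)], that is, an affine function of the elementary
    symmetric functions of [p].

    The cumulants are additive: the derivative of [log E e^(itX)] is the sum of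
    [i u_j], where [u_j = p_j e^(it) / (1 - p_j + p_j e^(it))] solves the
    logistic equation [u' = i u (1 - u)] and [u_j = p_j] at [t = 0].  Hence the
    cumulant of order [l + 1] is [sum_j P_l(p_j)] for a polynomial [P_l] of
    degree at most [l + 1] ([cumulant_BC]).  Consequently [D] is compact, and
    it is stable under any move inside the cube that preserves the sums
    [sum_j Q(p_j)] for all polynomials [Q] of degree at most [r].

    Such moves exist as soon as [p] takes [r + 1] distinct values in ]0, 1[.
    Choose one coordinate for each of these values [x_0, ..., x_r] and replace
    the [x_j] by the roots [y_j] of [prod_j (X - x_j) + e], which for small [e]
    are still in ]0, 1[ ([perturbed_roots]).  Only the constant coefficient,
    i.e. the elementary symmetric function of order [r + 1] of the chosen
    coordinates, is changed; so the sums of polynomials of degree at most [r]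
    are preserved ([sum_horner_const_shift]) and [BC_p g] changes by a constant
    multiple [a e] of [e], while the elementary symmetric function [E] of order
    [r + 1] of all the coordinates changes by [e], up to a common sign.

    So take [p] maximizing [BC_p g] over [D] and, among the maximizers,
    maximizing [E] ([lex_max]).  If [p] had [r + 1] distinct values in ]0, 1[,
    then [a <> 0] would allow [BC_p g] to be increased, whereas [a = 0] would
    allow [E] to be increased without changing [BC_p g].  Since the move can
    leave behind other coordinates with the old values, it need not reduce the
    number of values; this is why the choice of [p] has to be made by a second
    maximization. *)

Set Implicit Arguments.
Unset Strict Implicit.
Unset Printing Implicit Defensive.

Import Order.TTheory GRing.Theory Num.Theory.
Import numFieldNormedType.Exports.

Local Open Scope classical_set_scope.
Local Open Scope ring_scope.

(** * Laws with a polynomial generating function *)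

Section pgf.
Context (R : realType).
Notation RR := (measurableTypeR R).

(** The expectation of [phi] under the law with generating function [Q].  It is
    kept apart from the law because, unlike the law, it makes sense for
    polynomials that are not generating functions, and is linear in [Q]. *)
Definition coef_pairing (phi : nat -> R) (Q : {poly R}) : R :=
  \sum_(k < size Q) Q`_k * phi k.

Lemma coef_pairing_widen phi (Q : {poly R}) n : (size Q <= n)%N ->
  coef_pairing phi Q = \sum_(k < n) Q`_k * phi k.
Proof.
move=> sQ; rewrite /coef_pairing (big_ord_widen n (fun k => Q`_k * phi k)) //.
rewrite big_mkcond; apply: eq_bigr => k _; case: ltnP => // Qk.
by rewrite nth_default // mul0r.
Qed.

Fact coef_pairing_is_linear phi : scalar (coef_pairing phi).
Proof.
move=> a P Q; have sPQ := size_polyD (a *: P) Q.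
have saP := leq_trans (size_scale_leq a P) (leq_maxl (size P) (size Q)).
rewrite (@coef_pairing_widen _ _ (maxn (size P) (size Q))); last first.
  by rewrite (leq_trans sPQ) // geq_max saP leq_maxr.
rewrite (coef_pairing_widen _ (leq_maxl (size P) (size Q))).
rewrite (coef_pairing_widen _ (leq_maxr (size P) (size Q))).
rewrite mulr_sumr -big_split /=; apply: eq_bigr => k _.
by rewrite coefD coefZ mulrDl mulrA.
Qed.

HB.instance Definition _ phi := GRing.isLinear.Build R {poly R} R *%R
  (coef_pairing phi) (coef_pairing_is_linear phi).

Lemma coef_pairingXn phi n : coef_pairing phi 'X^n = phi n.
Proof.
rewrite /coef_pairing size_polyXn big_ord_recr /= coefXn eqxx mul1r big1 ?add0r // => k _.
by rewrite coefXn ltn_eqF ?mul0r.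
Qed.

(** Products of generating functions correspond to sums of independent
    variables: this is the transfer formula for the law of the sum. *)
Lemma coef_pairingM phi (P Q : {poly R}) :
  coef_pairing phi (P * Q) =
  coef_pairing (fun j => coef_pairing (fun k => phi (j + k)%N) Q) P.
Proof.
rewrite -[in LHS](coefK P) -[in LHS](coefK Q) !poly_def mulr_suml raddf_sum /=.
apply: eq_bigr => j _; rewrite -scalerAl linearZ /=; congr (_ * _).
rewrite mulr_sumr raddf_sum; apply: eq_bigr => k _.
by rewrite /= -scalerAr linearZ /= -exprD coef_pairingXn.
Qed.

(** Equality is demanded on measurable sets only: two probabilities that agree
    there need not be equal as records.  Identities between laws are therefore
    obtained from identities between generating functions, never by rewriting
    with the algebraic laws of convolution. *)
Definition has_pgf (P : realProb R) (Q : {poly R}) :=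
  (forall k, 0 <= Q`_k) /\
  forall A : set RR, measurable A ->
    P A = (coef_pairing (fun k => \1_A (k%:R : RR)) Q)%:E.

(** [P] coincides on measurable sets with a finite combination of Dirac
    measures, against which integrals are explicit. *)
Lemma ge0_integral_pgf (P : realProb R) (Q : {poly R}) (f : RR -> R) :
  has_pgf P Q -> measurable_fun setT f -> (forall x, 0 <= f x) ->
  (\int[P]_x (f x)%:E = (coef_pairing (fun k => f k%:R) Q)%:E)%E.
Proof.
move=> [Q0 PQ] mf f0.
have mEf : measurable_fun setT (fun x => (f x)%:E) by exact/measurable_EFinP.
pose m k := mscale (NngNum (Q0 k)) \d_(k%:R : RR).
have Pm (A : set RR) : measurable A -> A `<=` setT -> P A = msum m (size Q) A.
  move=> mA _; rewrite PQ // /msum -sumEFin; apply: eq_bigr => k _.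
  by rewrite EFinM.
rewrite (eq_measure_integral (msum m (size Q))) // ge0_integral_measure_sum //; last first.
  by move=> x _; rewrite lee_fin.
rewrite -sumEFin; apply: eq_bigr => k _.
rewrite ge0_integral_mscale //; last by move=> x _; rewrite lee_fin.
by rewrite integral_dirac // diracT mul1e.
Qed.

Lemma Rintegral_pgf (P : realProb R) (Q : {poly R}) (f : RR -> R) :
  has_pgf P Q -> measurable_fun setT f ->
  \int[P]_x f x = coef_pairing (fun k => f k%:R) Q.
Proof.
move=> PQ mf; rewrite /Rintegral integralE.
have mEf : measurable_fun setT (fun x => (f x)%:E) by exact/measurable_EFinP.
rewrite funerpos funerneg.
rewrite (ge0_integral_pgf PQ); [|exact: measurable_funrpos|exact: funrpos_ge0].
rewrite (ge0_integral_pgf PQ); [|exact: measurable_funrneg|exact: funrneg_ge0].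
rewrite -EFinB /= -sumrB; apply: eq_bigr => k _.
by rewrite -mulrBr -[in RHS](funrposBneg f).
Qed.

Lemma has_pgf_eq P P' Q (A : set RR) :
  has_pgf P Q -> has_pgf P' Q -> measurable A -> P A = P' A.
Proof. by move=> [_ h] [_ h'] mA; rewrite h // h'. Qed.

(** By definition of the product measure, the probability of [A] is the integral
    over [x] of the probability under [P2] of the translate [A - x]. *)
Lemma convolution_pgf P1 P2 Q1 Q2 : has_pgf P1 Q1 -> has_pgf P2 Q2 ->
  has_pgf (convolution P1 P2) (Q1 * Q2).
Proof.
move=> PQ1 PQ2; have [Q10 _] := PQ1; have [Q20 h2] := PQ2.
split=> [k|A mA].
  by rewrite coefM sumr_ge0 // => i _; rewrite mulr_ge0.
rewrite /convolution /distribution /pushforward /= /product_measure1.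
have mB : measurable (@Defs.add_pair R @^-1` A).
  by rewrite -[X in measurable X]setTI; exact: measurable_add_pair.
pose h (x : RR) : R := coef_pairing (fun k => \1_A (x + k%:R : RR)) Q2.
have hE x : P2 (xsection (@Defs.add_pair R @^-1` A) x) = (h x)%:E.
  rewrite h2; last exact: measurable_xsection.
  congr (_%:E); apply: eq_bigr => k _; congr (_ * _).
  rewrite !indicE; congr (_%:R); congr nat_of_bool.
  by apply/idP/idP; rewrite !inE /xsection /= inE.
under eq_integral do rewrite /= hE.
rewrite (ge0_integral_pgf PQ1).
- by rewrite coef_pairingM; congr (_%:E); apply: eq_bigr => j _;
    congr (_ * _); apply: eq_bigr => k _; rewrite natrD.
- apply: measurable_sum => k; apply: measurable_funM => //.
  apply: (measurableT_comp (f := \1_A : RR -> R)).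
    exact: measurable_indic.
  exact: measurable_funD.
- by move=> x; rewrite /h /coef_pairing sumr_ge0 // => k _; rewrite mulr_ge0.
Qed.

Lemma delta_pgf n : has_pgf (delta n%:R) 'X^n.
Proof.
split=> [k|A mA]; first by rewrite coefXn.
by rewrite coef_pairingXn /delta /= diracE indicE.
Qed.

(** Written in this way, the generating function is the value of [1 + p X] at
    [X - 1]; the polynomials [1 + p X] are those whose product has the
    elementary symmetric functions as coefficients. *)
Lemma bernoulli_pgf p : 0 <= p <= 1 -> has_pgf (bernoulliR p) (1 + p *: ('X - 1)).
Proof.
move=> p01; have [p0 p1] := andP p01.
have -> : 1 + p *: ('X - 1) = (1 - p) *: 'X^0 + p *: 'X^1 :> {poly R}.
  by rewrite expr0 expr1 scalerBl scale1r scalerBr -!addrA; congr (_ + _); rewrite addrC.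
split=> [k|A mA].
  rewrite coefD !coefZ !coefXn addr_ge0 // mulr_ge0 ?ler0n //; lra.
rewrite raddfD /= !linearZ /= !coef_pairingXn /bernoulliR /= /bernoulli_law p01.
by rewrite !diracE !indicE -!EFinM -EFinD.
Qed.

Lemma big_convolution_pgf (J : Type) (s : seq J) (P : pred J) (F : J -> realProb R)
    (Q : J -> {poly R}) :
  (forall j, P j -> has_pgf (F j) (Q j)) ->
  has_pgf (\big[convolution/delta 0]_(j <- s | P j) F j) (\prod_(j <- s | P j) Q j).
Proof.
move=> FQ; elim/big_rec2: _ => [|j p q Pj]; first by have := delta_pgf 0; rewrite expr0.
by apply: convolution_pgf; exact: FQ.
Qed.

End pgf.

(** * Bernoulli convolutions as polynomials *)

Lemma BC_pgf (R : realType) (I : finType) (p : I -> R) : (forall i, 0 <= p i <= 1) ->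
  has_pgf (BC p) (\prod_i (1 + p i *: ('X - 1))).
Proof. by move=> p01; apply: big_convolution_pgf => i _; exact: bernoulli_pgf. Qed.

Lemma binomial_pgf (R : realType) m (q : R) : 0 <= q <= 1 ->
  has_pgf (binomialR m q) ((1 + q *: ('X - 1)) ^+ m).
Proof.
move=> q01; rewrite -[X in _ ^+ X]card_ord -prodr_const.
by apply: big_convolution_pgf => i _; exact: bernoulli_pgf.
Qed.

(** The factors of the product over [I] are grouped according to the value of
    [p]; the hypothesis on [F 0] makes the value 0 disappear. *)
Lemma prod_by_inner_value (R : realType) (I : finType) (p : I -> R) (F : R -> {poly R})
    N (q : nat -> R) : F 0 = 1 ->
  set_bij [set j | (1 <= j <= N)%N] (inner_values p) q ->
  F 1 ^+ multiplicity p 1 * \prod_(1 <= j < N.+1) F (q j) ^+ multiplicity p (q j)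
  = \prod_i F (p i).
Proof.
move=> F0 [qin qinj qsurj].
have FE x : F x ^+ multiplicity p x = \prod_(i | p i == x) F (p i).
  rewrite /multiplicity -prodr_const; apply: eq_big => [i|i /eqP ->] //.
rewrite FE (eq_bigr _ (fun j _ => FE (q j))).
rewrite (exchange_big_dep xpredT) //= big_mkcond -big_split; apply: eq_bigr => i _ /=.
have [pi1|pi1] := eqVneq (p i) 1.
  rewrite big1_seq ?mulr1 // => j; rewrite mem_index_iota ltnS => /andP[/eqP pq jN].
  by have [_ /= []] := qin _ jN; right; rewrite -pq.
have [pi0|pi0] := eqVneq (p i) 0; first by rewrite big1 ?mul1r pi0.
have [|j0 /= jN qj] := qsurj (p i).
  by split; [exists i|move=> /= [] /eqP; apply/negP].
rewrite mul1r big_mkcond (bigD1_seq j0) ?iota_uniq ?mem_index_iota ?ltnS //=.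
rewrite qj eqxx big1_seq ?mulr1 // => j.
rewrite mem_index_iota ltnS => /andP[/eqP jj jN']; case: eqP => // pq.
by case: jj; apply: qinj; rewrite ?inE //= qj pq.
Qed.

Lemma BC_binomial_decomposition (R : realType) (I : finType) (p : I -> R) N (q : nat -> R) :
  (forall i, 0 <= p i <= 1) ->
  set_bij [set j | (1 <= j <= N)%N] (inner_values p) q ->
  forall A : set (measurableTypeR R), measurable A ->
  BC p A = convolution (delta (multiplicity p 1)%:R)
       (\big[convolution/delta 0]_(1 <= j < N.+1)
          binomialR (multiplicity p (q j)) (q j)) A.
Proof.
move=> p01 qbij A mA.
pose F (x : R) : {poly R} := 1 + x *: ('X - 1).
have F0 : F 0 = 1 by rewrite /F scale0r addr0.
have F1 : F 1 = 'X by rewrite /F scale1r addrC subrK.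
apply: (has_pgf_eq (BC_pgf p01)) => //.
rewrite -(prod_by_inner_value F0 qbij) F1; apply: convolution_pgf.
  exact: delta_pgf.
rewrite [\big[convolution/_]_(_ <= _ < _) _]big_nat_cond [\prod_(_ <= _ < _) _]big_nat_cond.
apply: big_convolution_pgf => j; rewrite ltnS andbT => jN; apply: binomial_pgf.
by have [qin _ _] := qbij; have [[i _ <-] _] := qin _ jN.
Qed.

Lemma expect_BC (R : realType) (I : finType) (g : 'I_#|I|.+1 -> R) (p : I -> R) :
  (forall i, 0 <= p i <= 1) ->
  expect (BC p) g =
  coef_pairing (fun k => extend0 g k%:R) (\prod_i (1 + p i *: ('X - 1))).
Proof.
move=> p01; apply: Rintegral_pgf; first exact: BC_pgf.
apply: measurable_sum => k; apply: measurable_funM => //.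
Qed.

Lemma prod_comp_XsubC1 (R : realType) (I : finType) (p : I -> R) :
  \prod_i (1 + p i *: ('X - 1)) = (\prod_i (1 + p i *: 'X)) \Po ('X - 1).
Proof.
rewrite rmorph_prod; apply: eq_bigr => i _.
by rewrite /= comp_polyD comp_polyZ comp_polyX comp_polyC.
Qed.

(** * Cumulants of Bernoulli convolutions *)

Section cderiv.
Local Open Scope complex_scope.
Context {R : realType}.
Implicit Types (f g : R -> R[i]) (t : R) (a b : R[i]).

(** Componentwise, in accordance with [cderive]. *)
Definition has_cderive f t a :=
  is_derive t (1 : R) (fun s => complex.Re (f s)) (complex.Re a) /\
  is_derive t (1 : R) (fun s => complex.Im (f s)) (complex.Im a).

Lemma is_deriveM_fun (f g : R -> R) t (a b : R) : is_derive t (1 : R) f a ->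
  is_derive t (1 : R) g b ->
  is_derive t (1 : R) (fun s => f s * g s) (f t * b + a * g t).
Proof.
move=> fa gb; have h := is_deriveM fa gb; apply: (is_derive_eq h).
by rewrite [a * _]mulrC.
Qed.

Lemma is_deriveD_fun (f g : R -> R) t (a b : R) : is_derive t (1 : R) f a ->
  is_derive t (1 : R) g b -> is_derive t (1 : R) (fun s => f s + g s) (a + b).
Proof. by move=> fa gb; exact: is_deriveD. Qed.

Lemma is_deriveB_fun (f g : R -> R) t (a b : R) : is_derive t (1 : R) f a ->
  is_derive t (1 : R) g b -> is_derive t (1 : R) (fun s => f s - g s) (a - b).
Proof. by move=> fa gb; exact: is_deriveB. Qed.

Lemma has_cderive_eq f t a b : has_cderive f t a -> a = b -> has_cderive f t b.
Proof. by move=> fa <-. Qed.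

Lemma has_cderive_cst a t : has_cderive (fun=> a) t 0.
Proof. by split; exact: is_derive_cst. Qed.

Lemma has_cderiveD f g t a b : has_cderive f t a -> has_cderive g t b ->
  has_cderive (fun s => f s + g s) t (a + b).
Proof.
move=> [fr fi] [gr gi]; split.
- rewrite raddfD (_ : (fun s => _) = fun s => complex.Re (f s) + complex.Re (g s)).
    exact: is_deriveD.
  by apply/funext => s; case: (f s) (g s) => [? ?] [? ?].
- rewrite raddfD (_ : (fun s => _) = fun s => complex.Im (f s) + complex.Im (g s)).
    exact: is_deriveD.
  by apply/funext => s; case: (f s) (g s) => [? ?] [? ?].
Qed.

Lemma has_cderiveM f g t a b : has_cderive f t a -> has_cderive g t b ->
  has_cderive (fun s => f s * g s) t (a * g t + f t * b).
Proof.
move=> [fr fi] [gr gi]; split.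
- rewrite (_ : (fun s => _) = fun s => complex.Re (f s) * complex.Re (g s)
                - complex.Im (f s) * complex.Im (g s)); last first.
    by apply/funext => s; case: (f s) (g s) => [? ?] [? ?].
  apply: (is_derive_eq (is_deriveB_fun (is_deriveM_fun fr gr) (is_deriveM_fun fi gi))).
  by case: a b (f t) (g t) {fr fi gr gi} => [? ?] [? ?] [? ?] [? ?] /=; ring.
- rewrite (_ : (fun s => _) = fun s => complex.Re (f s) * complex.Im (g s)
                + complex.Im (f s) * complex.Re (g s)); last first.
    by apply/funext => s; case: (f s) (g s) => [? ?] [? ?].
  apply: (is_derive_eq (is_deriveD_fun (is_deriveM_fun fr gi) (is_deriveM_fun fi gr))).
  by case: a b (f t) (g t) {fr fi gr gi} => [? ?] [? ?] [? ?] [? ?] /=; ring.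
Qed.

Lemma sqr_norm_neq0 (x y : R) : x +i* y != 0 -> x ^+ 2 + y ^+ 2 != 0.
Proof.
apply: contraNneq => /eqP; rewrite paddr_eq0 ?sqr_ge0 // !sqrf_eq0.
by move=> /andP[/eqP-> /eqP->].
Qed.

Lemma is_derive_sqr_norm (u v : R -> R) t (a b : R) : is_derive t (1 : R) u a ->
  is_derive t (1 : R) v b ->
  is_derive t (1 : R) (fun s => u s ^+ 2 + v s ^+ 2) (2 * (u t * a + v t * b)).
Proof.
move=> ua vb; rewrite (_ : (fun s => _) = fun s => u s * u s + v s * v s) //.
apply: (is_derive_eq (is_deriveD_fun (is_deriveM_fun ua ua) (is_deriveM_fun vb vb))).
ring.
Qed.

Lemma is_derive_div_fun (u v : R -> R) t (a b : R) : v t != 0 -> is_derive t (1 : R) u a ->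
  is_derive t (1 : R) v b ->
  is_derive t (1 : R) (fun s => u s / v s) ((a * v t - u t * b) / v t ^+ 2).
Proof.
move=> vt ua vb; apply: (is_derive_eq (is_deriveM_fun ua (is_deriveV vt vb))).
by rewrite /GRing.scale /=; field.
Qed.

Lemma has_cderiveV f t a : f t != 0 -> has_cderive f t a ->
  has_cderive (fun s => (f s)^-1) t (- (a / f t ^+ 2)).
Proof.
move=> ft [fr fi].
pose n s := complex.Re (f s) ^+ 2 + complex.Im (f s) ^+ 2.
have n0 : n t != 0 by apply: sqr_norm_neq0; case: (f t) ft.
have dn : is_derive t (1 : R) n _ := is_derive_sqr_norm fr fi; split.
- rewrite (_ : (fun s => _) = fun s => complex.Re (f s) / n s); last first.
    by apply/funext => s; rewrite /n; case: (f s).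
  apply: (is_derive_eq (is_derive_div_fun n0 fr dn)).
  move: n0; rewrite {dn fr fi} /n; case: (f t) a ft => [x y] [u v] /= ft n0.
  (* the squared norm of the square of x + iy *)
  have -> : (x * x - y * y) ^+ 2 + (x * y + y * x) ^+ 2 = (x ^+ 2 + y ^+ 2) ^+ 2.
    ring.
  by field.
- rewrite (_ : (fun s => _) = fun s => - (complex.Im (f s) / n s)); last first.
    by apply/funext => s; rewrite /n; case: (f s).
  apply: (is_derive_eq (is_deriveN (is_derive_div_fun n0 fi dn))).
  move: n0; rewrite {dn fr fi} /n; case: (f t) a ft => [x y] [u v] /= ft n0.
  (* the squared norm of the square of x + iy *)
  have -> : (x * x - y * y) ^+ 2 + (x * y + y * x) ^+ 2 = (x ^+ 2 + y ^+ 2) ^+ 2.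
    ring.
  by field.
Qed.

(** The logarithmic form of the hypothesis makes the product rule a sum of the
    [d i], which is where the additivity of cumulants comes from. *)
Lemma has_cderive_prod (I : Type) (r : seq I) (f : I -> R -> R[i]) t (d : I -> R[i]) :
  (forall i, has_cderive (f i) t (f i t * d i)) ->
  has_cderive (fun s => \prod_(i <- r) f i s) t
    ((\prod_(i <- r) f i t) * \sum_(i <- r) d i).
Proof.
move=> fd; elim: r => [|i r IHr].
  rewrite (_ : (fun s => _) = fun=> 1); last by apply/funext => s; rewrite big_nil.
  by rewrite !big_nil mulr0; exact: has_cderive_cst.
rewrite (_ : (fun s => _) = fun s => f i s * \prod_(j <- r) f j s); last first.
  by apply/funext => s; rewrite big_cons.
apply: (has_cderive_eq (has_cderiveM (fd i) IHr)).
rewrite !big_cons; ring.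
Qed.

Lemma has_cderive_sum (I : Type) (r : seq I) (f : I -> R -> R[i]) t (d : I -> R[i]) :
  (forall i, has_cderive (f i) t (d i)) ->
  has_cderive (fun s => \sum_(i <- r) f i s) t (\sum_(i <- r) d i).
Proof.
move=> fd; elim: r => [|i r IHr].
  rewrite (_ : (fun s => _) = fun=> 0); last by apply/funext => s; rewrite big_nil.
  by rewrite !big_nil; exact: has_cderive_cst.
rewrite (_ : (fun s => _) = fun s => f i s + \sum_(j <- r) f j s); last first.
  by apply/funext => s; rewrite big_cons.
by apply: (has_cderive_eq (has_cderiveD (fd i) IHr)); rewrite big_cons.
Qed.

Lemma has_cderive_horner (Q : {poly R}) f t a : has_cderive f t a ->
  has_cderive (fun s => (map_poly (real_complex R) Q).[f s]) t
    ((map_poly (real_complex R) Q^`()).[f t] * a).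
Proof.
move=> fa; elim/poly_ind: Q => [|Q c IHQ].
  rewrite (_ : (fun s => _) = fun=> 0); last by apply/funext => s; rewrite rmorph0 horner0.
  by rewrite deriv0 rmorph0 horner0 mul0r; exact: has_cderive_cst.
rewrite (_ : (fun s => _) =
    fun s => (map_poly (real_complex R) Q).[f s] * f s + c%:C); last first.
  by apply/funext => s; rewrite rmorphD rmorphM /= map_polyX map_polyC !hornerE.
apply: (has_cderive_eq (has_cderiveD (has_cderiveM IHQ fa) (has_cderive_cst c%:C _))).
rewrite derivD derivM derivX derivC !rmorphD !rmorphM rmorph0 /=.
rewrite map_polyX map_polyC !hornerE; ring.
Qed.

(** On the right half-plane, where the characteristic functions lie for small
    [t], the argument is given by a formula that is differentiable across the
    real axis, unlike its definition by cases. *)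
Lemma carg_atan (z : R[i]) : 0 < complex.Re z ->
  carg z = atan (complex.Im z / complex.Re z).
Proof.
case: z => x y /= x0; rewrite /carg /=.
have npos : 0 < Num.sqrt (x ^+ 2 + y ^+ 2).
  by rewrite sqrtr_gt0 ltr_pwDl ?exprn_gt0 ?sqr_ge0.
have -> : x / Num.sqrt (x ^+ 2 + y ^+ 2) = cos (atan (y / x)).
  rewrite cos_atan; have -> : 1 + (y / x) ^+ 2 = (x ^+ 2 + y ^+ 2) / x ^+ 2.
    by field; rewrite gt_eqF.
  rewrite sqrtrM ?addr_ge0 ?sqr_ge0 // sqrtrV ?sqr_ge0 // sqrtr_sqr gtr0_norm //.
  by rewrite invf_div.
have p0 := pi_gt0 R; have h1 := atan_gtNpi2 (y / x); have h2 := atan_ltpi2 (y / x).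
have [y0|y0] := leP 0 y.
  rewrite cosK // in_itv /=; have : atan 0 <= atan (y / x).
    by apply: le_atan; rewrite divr_ge0 // ltW.
  rewrite atan0 => ->; lra.
rewrite cosKN ?opprK //; have : atan (y / x) < atan 0.
  by apply: lt_atan; rewrite pmulr_llt0 // invr_gt0.
rewrite atan0 => h; lra.
Qed.

Lemma has_cderive_continuous f t a : has_cderive f t a ->
  {for t, continuous (fun s => complex.Re (f s))}.
Proof.
by move=> [[d _] _]; apply: differentiable_continuous; exact/derivable1_diffP.
Qed.

Lemma has_cderive_clog f t a : 0 < complex.Re (f t) -> has_cderive f t a ->
  has_cderive (fun s => clog (f s)) t (a / f t).
Proof.
move=> f0 fa; have fcont := has_cderive_continuous fa; have [fr fi] := fa.
pose n s := complex.Re (f s) ^+ 2 + complex.Im (f s) ^+ 2.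
have n0 : 0 < n t by rewrite /n ltr_pwDl ?exprn_gt0 ?sqr_ge0.
have dn : is_derive t (1 : R) n _ := is_derive_sqr_norm fr fi; split.
- have sn0 : 0 < Num.sqrt (n t) by rewrite sqrtr_gt0.
  have h1 := is_derive1_comp (is_derive1_ln sn0) (is_derive1_sqrt n0).
  rewrite (_ : (fun s => _) = (@ln R \o Num.sqrt) \o n); last first.
    by apply/funext => s; rewrite /clog /n /=; case: (f s).
  apply: (is_derive_eq (is_derive1_comp h1 dn)).
  have -> : (Num.sqrt (n t))^-1 / (2 * Num.sqrt (n t)) = (2 * n t)^-1.
    by rewrite -[in RHS](sqr_sqrtr (ltW n0)); field; rewrite gt_eqF.
  move: n0; rewrite {h1 dn fr fi fa fcont sn0} /n.
  case: (f t) a f0 => [x y] [u v] /= x0 n0.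
  have {}n0 : x ^+ 2 + y ^+ 2 != 0 by rewrite gt_eqF.
  by field.
- have fneq : complex.Re (f t) != 0 by rewrite gt_eqF.
  have h1 := is_derive_div_fun fneq fi fr.
  have h2 := is_derive1_comp (is_derive1_atan _) h1.
  apply: (@near_eq_is_derive _ _ _
    (atan \o (fun s => complex.Im (f s) / complex.Re (f s)))).
    have : \forall s \near t, 0 < complex.Re (f s).
      exact: (cvgr_gt _ fcont).
    by apply: filterS => s fs /=; rewrite carg_atan.
  apply: (is_derive_eq h2).
  move: n0; rewrite {h1 h2 dn fr fi fa fcont} /n.
  case: (f t) a f0 fneq => [x y] [u v] /= x0 xneq n0.
  have {}n0 : x ^+ 2 + y ^+ 2 != 0 by rewrite gt_eqF.
  by field; rewrite n0.
Qed.

Definition cis t : R[i] := cos t +i* sin t.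

Lemma cisD s t : cis (s + t) = cis s * cis t.
Proof. by rewrite /cis cosD sinD; congr (_ +i* _); rewrite addrC. Qed.

Lemma cisMn n t : cis (t * n%:R) = cis t ^+ n.
Proof.
elim: n => [|n IHn]; first by rewrite mulr0 /cis cos0 sin0 expr0.
by rewrite -addn1 natrD mulrDr mulr1 cisD IHn exprD expr1.
Qed.

Lemma has_cderive_cis t : has_cderive cis t ((0 +i* 1) * cis t).
Proof.
split.
  apply: (is_derive_eq (is_derive_cos t)) => /=; ring.
apply: (is_derive_eq (is_derive_sin t)) => /=; ring.
Qed.

Lemma char_fun_pgf P Q t : has_pgf P Q ->
  char_fun P t = (map_poly (real_complex R) Q).[cis t].
Proof.
move=> PQ; rewrite /char_fun.
have mt : measurable_fun setT (fun x : measurableTypeR R => t * x).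
  exact: measurable_funM.
rewrite (Rintegral_pgf PQ); last first.
  apply: (measurableT_comp (f := cos)) => //.
  by apply: continuous_measurable_fun; exact: continuous_cos.
rewrite (Rintegral_pgf PQ); last first.
  apply: (measurableT_comp (f := sin)) => //.
  by apply: continuous_measurable_fun; exact: continuous_sin.
rewrite horner_coef size_map_poly /coef_pairing.
elim/big_rec3: _ => //= k a b c _ <-.
rewrite coef_map /= -cisMn /=; congr (_ +i* _); ring.
Qed.

(** The characteristic function of the Bernoulli law. *)
Definition bernoulli_char p t : R[i] := 1 + p%:C * (cis t - 1).

(** The complex success probability of the Bernoulli law tilted by [e^(itx)]; it
    is also the logarithmic derivative of [bernoulli_char p] divided by [i]. *)
Definition tilted p t : R[i] := p%:C * cis t / bernoulli_char p t.

Lemma char_fun_BC (I : finType) (p : I -> R) t : (forall i, 0 <= p i <= 1) ->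
  char_fun (BC p) t = \prod_i bernoulli_char (p i) t.
Proof.
move=> p01; rewrite (char_fun_pgf _ (BC_pgf p01)) rmorph_prod horner_prod.
apply: eq_bigr => i _; rewrite rmorphD rmorph1 -mul_polyC rmorphM rmorphB rmorph1 /=.
by rewrite map_polyX map_polyC !hornerE.
Qed.

Lemma has_cderive_bernoulli_char p t :
  has_cderive (bernoulli_char p) t ((0 +i* 1) * (p%:C * cis t)).
Proof.
have h := has_cderiveD (has_cderive_cst 1 t) (has_cderiveM (has_cderive_cst p%:C t)
  (has_cderiveD (has_cderive_cis t) (has_cderive_cst (- 1) t))).
apply: (has_cderive_eq h); ring.
Qed.

(** The logistic equation, thanks to which the higher derivatives of the logarithm
    of the characteristic function remain polynomials in [tilted]. *)
Lemma has_cderive_tilted p t : bernoulli_char p t != 0 ->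
  has_cderive (tilted p) t ((0 +i* 1) * (tilted p t * (1 - tilted p t))).
Proof.
move=> b0; have h := has_cderiveM
  (has_cderiveM (has_cderive_cst p%:C t) (has_cderive_cis t))
  (has_cderiveV b0 (has_cderive_bernoulli_char p t)).
apply: (has_cderive_eq h); rewrite /tilted; by field.
Qed.

(** The cumulant of order [l + 1] (not [l]) of the Bernoulli law, as a polynomial
    in [p]; the recursion is the chain rule for the logistic equation. *)
Fixpoint cumulant_poly (l : nat) : {poly R} :=
  if l is l'.+1 then (cumulant_poly l')^`() * ('X * (1 - 'X)) else 'X.

Lemma size_cumulant_poly l : (size (cumulant_poly l) <= l.+2)%N.
Proof.
elim: l => [|l IHl] /=; first by rewrite size_polyX.
have s1 : (size (1 - 'X : {poly R})%R <= 2)%N.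
  by rewrite (leq_trans (size_polyD _ _)) // size_polyN size_polyX size_poly1.
have s2 := size_polyMleq 'X (1 - 'X : {poly R}); rewrite size_polyX in s2.
have s3 := size_polyMleq (cumulant_poly l)^`() ('X * (1 - 'X)).
have [c0|c0] := eqVneq (cumulant_poly l) 0.
  by rewrite c0 deriv0 mul0r size_poly0.
apply: (leq_trans s3); move: s1 s2 IHl (lt_size_deriv c0).
move: (size (1 - 'X)) (size ('X * _)) (size (cumulant_poly l)) (size _^`()).
lia.
Qed.

(** The induction step for iterated derivatives: equality at 0 alone would not be
    enough, a neighbourhood is needed to differentiate once more. *)
Lemma cderive_step f (G : R -> R[i]) n (G' : R -> R[i]) :
  (\forall t \near (0 : R), cderive n f t = G t) ->
  (\forall t \near (0 : R), has_cderive G t (G' t)) ->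
  \forall t \near (0 : R), cderive n.+1 f t = G' t.
Proof.
move=> /near_join fG GG'; near=> t.
have fGt : \near t, cderive n f t = G t by near: t.
have [gr gi] : has_cderive G t (G' t) by near: t.
rewrite /cderive !derive1nS !derive1E.
rewrite (_ : 'D_1 _ t = complex.Re (G' t)); last first.
  by rewrite -(@derive_val _ _ _ _ _ _ _ gr); apply: near_eq_derive;
     apply: filterS fGt => s /= <-.
rewrite (_ : 'D_1 _ t = complex.Im (G' t)); last first.
  by rewrite -(@derive_val _ _ _ _ _ _ _ gi); apply: near_eq_derive;
     apply: filterS fGt => s /= <-.
by case: (G' t).
Unshelve. all: by end_near. Qed.

Lemma near_Re_gt0 f a : has_cderive f 0 a -> f 0 = 1 ->
  \forall t \near (0 : R), 0 < complex.Re (f t).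
Proof.
move=> fa f0; apply: (cvgr_gt _ (has_cderive_continuous fa)).
by rewrite f0 /= ltr01.
Qed.

Lemma bernoulli_char0 p : bernoulli_char p 0 = 1.
Proof. by rewrite /bernoulli_char /cis cos0 sin0 subrr mulr0 addr0. Qed.

Lemma bernoulli_char_neq0 p : \forall t \near (0 : R), bernoulli_char p t != 0.
Proof.
have := near_Re_gt0 (has_cderive_bernoulli_char p 0) (bernoulli_char0 p).
by apply: filterS => t; apply: contraTneq => ->; rewrite ltxx.
Qed.

(** Near 0 the derivative of order [l + 1] of the logarithm of the characteristic
    function is [i^(l+1) sum_j P_l(u_j)], with [u_j] the tilted probabilities;
    these are equal to [p_j] at 0. *)
Lemma cumulant_BC (I : finType) (p : I -> R) l : (forall i, 0 <= p i <= 1) ->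
  cumulant l.+1 (BC p) = (\sum_i (cumulant_poly l).[p i])%:C.
Proof.
move=> p01; pose iu : R[i] := 0 +i* 1.
pose L t := clog (char_fun (BC p) t).
have near_neq0 : \forall t \near (0 : R), forall i, bernoulli_char (p i) t != 0.
  apply: (@filter_forall _ _ (fun i t => bernoulli_char (p i) t != 0) _
    (nbhs_filter (0 : R))).
  by move=> i; exact: bernoulli_char_neq0.
have dprod t : (forall i, bernoulli_char (p i) t != 0) ->
  has_cderive (fun t => \prod_i bernoulli_char (p i) t) t
    ((\prod_i bernoulli_char (p i) t) * \sum_i (iu * tilted (p i) t)).
  move=> b0; apply: has_cderive_prod => i.
  apply: (has_cderive_eq (has_cderive_bernoulli_char (p i) t)).
  by rewrite /tilted /iu; field.
have near_pos : \forall t \near (0 : R), 0 < complex.Re (\prod_i bernoulli_char (p i) t).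
  apply: near_Re_gt0; first by apply: dprod => i; rewrite bernoulli_char0 oner_neq0.
  by rewrite big1 // => i _; rewrite bernoulli_char0.
have dL l' : \forall t \near (0 : R), cderive l'.+1 L t =
    \sum_i (iu ^+ l'.+1 * (map_poly (real_complex R) (cumulant_poly l')).[tilted (p i) t]).
  elim: l' => [|l' IHl].
    have L0 : \forall t \near (0 : R),
        cderive 0 L t = clog (\prod_i bernoulli_char (p i) t).
      by near=> t; rewrite /cderive !derive1n0 /L char_fun_BC //; case: (clog _).
    apply: (cderive_step L0); near=> t.
    have b0 : forall i, bernoulli_char (p i) t != 0 by near: t.
    have pos : 0 < complex.Re (\prod_i bernoulli_char (p i) t) by near: t.
    apply: (has_cderive_eq (has_cderive_clog pos (dprod t b0))).
    rewrite mulrC mulKf; last by apply/prodf_neq0 => i _; exact: b0.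
    by apply: eq_bigr => i _; rewrite expr1 /= map_polyX hornerX.
  apply: (cderive_step IHl); near=> t.
  have b0 : forall i, bernoulli_char (p i) t != 0 by near: t.
  apply: has_cderive_sum => i.
  have h := has_cderiveM (has_cderive_cst (iu ^+ l'.+1) t)
    (has_cderive_horner (cumulant_poly l') (has_cderive_tilted (b0 i))).
  apply: (has_cderive_eq h).
  rewrite [cumulant_poly l'.+1]/= !(rmorphM, rmorphB, rmorph1) /= !map_polyX.
  rewrite !(hornerM, hornerD, hornerN, hornerX, hornerC) (exprS iu l'.+1) -/iu.
  ring.
rewrite /cumulant -/L (nbhs_singleton (dL l)) -mulr_sumr mulKf.
  rewrite rmorph_sum; apply: eq_bigr => i _.
  have -> : tilted (p i) 0 = (p i)%:C.
    by rewrite /tilted /bernoulli_char /cis cos0 sin0 subrr mulr0 addr0 divr1 mulr1.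
  by rewrite horner_map.
by rewrite expf_neq0 // /iu eq_complex /= eqxx oner_eq0.
Unshelve. all: by end_near.
Qed.

End cderiv.

(** * Shifting the constant coefficient of a split polynomial *)

Lemma deriv_prod_XsubC (F : comNzRingType) m (x : 'I_m -> F) :
  (\prod_j ('X - (x j)%:P))^`() = \sum_j \prod_(k | k != j) ('X - (x k)%:P).
Proof.
elim: m x => [|m IHm] x; first by rewrite !big_ord0 derivC.
rewrite !big_ord_recl derivM derivXsubC mul1r IHm mulr_sumr; congr (_ + _).
  by rewrite [RHS]big_mkcond big_ord_recl /= mul1r.
apply: eq_bigr => j _; rewrite [RHS]big_mkcond big_ord_recl /=; congr (_ * _).
by rewrite big_mkcond; apply: eq_bigr => k _; rewrite (inj_eq lift_inj).
Qed.

(** Writing [f] for the product, [f' = sum_j f / (X - x_j)], and [Q] times the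
    [j]-th summand is [Q(x_j) f / (X - x_j)] modulo [f].  As
    [f / (X - x_j)] is monic of degree [m], the sum of the values of [Q] at the
    roots is the coefficient of order [m] of the remainder of [Q f'] modulo
    [f]. *)
Lemma horner_mul_deriv_prod (F : fieldType) m (x : 'I_m.+1 -> F) (Q : {poly F}) :
  (size Q <= m.+1)%N ->
  exists A B : {poly F}, [/\ Q * (\prod_j ('X - (x j)%:P))^`()
      = A * \prod_j ('X - (x j)%:P) + B,
    (size A <= m)%N, (size B <= m.+1)%N & B`_m = \sum_j Q.[x j]].
Proof.
move=> sQ; set f : {poly _} := \prod_j _.
pose g j := \prod_(k | k != j) ('X - (x k)%:P).
have fE j : f = ('X - (x j)%:P) * g j by rewrite /f (bigD1 j).
have sg j : size (g j) = m.+1.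
  have := congr1 (fun q : {poly F} => size q) (fE j).
  rewrite /f size_prod_XsubC /index_enum -enumT size_enum_ord mulrC.
  rewrite size_Mmonic ?monicXsubC ?size_XsubC ?addn2 //= => [[]//|].
  exact/monic_neq0/monic_prod_XsubC.
have gm j : (g j)`_m = 1.
  have /monicP := monic_prod_XsubC (index_enum 'I_m.+1) (fun k => k != j) x.
  by rewrite lead_coefE -/(g j) sg.
have /choice[A AE] j : exists A, Q - (Q.[x j])%:P = A * ('X - (x j)%:P).
  by apply/factor_theorem; rewrite /root !hornerE subrr.
have sA j : (size (A j) <= m)%N.
  have [->|A0] := eqVneq (A j) 0; first by rewrite size_poly0.
  have := congr1 (fun q : {poly F} => size q) (AE j).
  rewrite size_Mmonic ?monicXsubC ?size_XsubC ?addn2 //= => eqs.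
  rewrite -ltnS -eqs (leq_trans (size_polyD _ _)) // geq_max sQ size_polyN.
  by rewrite (leq_trans (size_polyC_leq1 _)).
exists (\sum_j A j), (\sum_j (Q.[x j])%:P * g j); split.
- rewrite deriv_prod_XsubC mulr_sumr mulr_suml -big_split /=.
  apply: eq_bigr => j _; rewrite -/(g j) (fE j) mulrA -AE mulrBl subrK //.
- by apply: (leq_trans (size_sum _ _ _)); apply/bigmax_leqP.
- apply: (leq_trans (size_sum _ _ _)); apply/bigmax_leqP => j _.
  by rewrite mul_polyC (leq_trans (size_scale_leq _ _)) ?sg.
- by rewrite coef_sum; apply: eq_bigr => j _; rewrite coefCM gm mulr1.
Qed.

(** Adding a constant [e] to [f] does not change [f'].  If [Q f' = A f + B] then
    [Q f' = A (f + e) + (B - e A)], and [A] has degree less than [m], so that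
    the remainders have the same coefficient of order [m]. *)
Lemma sum_horner_const_shift (F : fieldType) m (x y : 'I_m.+1 -> F) e (Q : {poly F}) :
  \prod_j ('X - (y j)%:P) = \prod_j ('X - (x j)%:P) + e%:P ->
  (size Q <= m.+1)%N -> \sum_j Q.[y j] = \sum_j Q.[x j].
Proof.
move=> yx sQ.
have [A [B [AB sA sB <-]]] := horner_mul_deriv_prod x sQ.
have [A' [B' [AB' sA' sB' <-]]] := horner_mul_deriv_prod y sQ.
move: AB'; rewrite yx derivD derivC addr0 AB => /eqP.
set f : {poly _} := \prod_j _.
have sf : size f = m.+2.
  by rewrite /f size_prod_XsubC /index_enum -enumT size_enum_ord.
have fm : f \is monic by exact: monic_prod_XsubC.
move=> /eqP eq1.
have eq2 : (A - A') * f = B' + A' * e%:P - B.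
  have -> : B' = A * f + B - A' * (f + e%:P) by rewrite eq1; ring.
  ring.
have AA' : A - A' = 0.
  apply/eqP; apply: contraTT isT => A0.
  have := congr1 (fun q : {poly F} => size q) eq2.
  rewrite size_Mmonic // sf addnS /= => eqs.
  have : (size (B' + A' * e%:P - B)%R <= m.+1)%N.
    rewrite (leq_trans (size_polyD _ _)) // geq_max size_polyN sB andbT.
    rewrite (leq_trans (size_polyD _ _)) // geq_max sB' /=.
    rewrite mulrC mul_polyC (leq_trans (size_scale_leq _ _)) //.
    exact: leqW.
  by rewrite -eqs -[leqRHS]add0n leq_add2r leqNgt size_poly_gt0 A0.
move: eq2; rewrite AA' mul0r => /esym/eqP; rewrite subr_eq0 => /eqP <-.
by rewrite coefD coefMC [A'`_m]nth_default // mul0r addr0.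
Qed.

Lemma poly_eq_neq0 (F : numFieldType) (P Q : {poly F}) :
  (forall z, z != 0 -> P.[z] = Q.[z]) -> P = Q.
Proof.
move=> PQ; apply/eqP; rewrite -subr_eq0; apply/eqP.
pose s : seq F := [seq i.+1%:R | i <- iota 0 (size (P - Q))].
apply: (@roots_geq_poly_eq0 _ _ s).
- apply/allP => _ /mapP[i _ ->]; rewrite /root hornerD hornerN PQ ?subrr ?pnatr_eq0 //.
- rewrite /s map_inj_uniq ?iota_uniq // => i j /eqP.
  by rewrite eqr_nat => /eqP[].
- by rewrite size_map size_iota.
Qed.

(** [prod_j (1 + x_j z) = (- z)^m prod_j (- 1/z - x_j)]: the polynomials
    [1 + x_j X] are the reversed factors, and reversal turns the constant
    coefficient into the leading one. *)
Lemma prod_reciprocal (F : numFieldType) m (x y : 'I_m -> F) e :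
  \prod_j ('X - (y j)%:P) = \prod_j ('X - (x j)%:P) + e%:P ->
  \prod_j (1 + (y j) *: 'X) = \prod_j (1 + (x j) *: 'X) + ((-1) ^+ m * e) *: 'X^m.
Proof.
move=> yx; apply: poly_eq_neq0 => z z0.
have rev (w : 'I_m -> F) :
  (\prod_j (1 + w j *: 'X)).[z] = (- z) ^+ m * (\prod_j ('X - (w j)%:P)).[- z^-1].
  rewrite !horner_prod -[in (- z) ^+ m](card_ord m) -prodr_const -big_split /=.
  by apply: eq_bigr => j _; rewrite !hornerE; field.
rewrite hornerD hornerZ hornerXn !rev yx [(_ + e%:P).[_]]hornerD hornerC.
by rewrite [(- z) ^+ m]exprNn; ring.
Qed.

(** Each root [x_j] is simple, so the product changes sign between [x_j - d] and
    [x_j + d] for small [d], and this persists after adding a small constant;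
    the intermediate value theorem provides [y_j].  For small [d] the intervals
    are disjoint, so that [y_0, ..., y_m] are all the roots of the perturbed
    polynomial. *)
Lemma perturbed_roots (R : realType) m (x : 'I_m.+1 -> R) :
  injective x -> (forall j, 0 < x j < 1) ->
  \forall e \near (0 : R), exists y : 'I_m.+1 -> R, (forall j, 0 < y j < 1) /\
    \prod_j ('X - (y j)%:P) = \prod_j ('X - (x j)%:P) + e%:P.
Proof.
move=> xinj x01.
have [d [d0 xd sep]] : exists d, [/\ 0 < d, forall j, d < x j /\ d < 1 - x j &
    forall i j, i != j -> d + d < `|x i - x j|].
  have n1 : \forall d \near (0 : R)^'+, forall j, d < x j /\ d < 1 - x j.
    apply: filter_forall => j; have /andP[x0 x1] := x01 j.
    by near=> d; split; near: d; apply: nbhs_right_lt => //; rewrite subr_gt0.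
  have n2 : \forall d \near (0 : R)^'+,
      forall i j, i != j -> d + d < `|x i - x j|.
    apply: filter_forall => i; apply: filter_forall => j.
    have [->|ij] /= := eqVneq i j; first by near=> d.
    near=> d => _; have : d < `|x i - x j| / 2.
      near: d; apply: nbhs_right_lt; rewrite divr_gt0 // normr_gt0 subr_eq0.
      by rewrite (inj_eq xinj).
    by rewrite ltr_pdivlMr // mulr_natr mulr2n.
  near ((0 : R)^'+) => d; exists d; split => //; first by near: d; exact: n1.
  by near: d; exact: n2.
set f : {poly _} := \prod_j _.
have fE j z : f.[z] = (z - x j) * \prod_(k | k != j) (z - x k).
  rewrite /f (bigD1 j) //= hornerM horner_prod !hornerE; congr (_ * _).
  by apply: eq_bigr => k _; rewrite !hornerE.
(* the factors other than the j-th have the same sign at both end points *)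
have fneg j : f.[x j - d] * f.[x j + d] < 0.
  rewrite !(fE j) mulrACA -big_split /=.
  have -> : (x j - d - x j) * (x j + d - x j) = - (d * d) by ring.
  rewrite nmulr_rlt0 ?oppr_lt0 ?mulr_gt0 //; apply: prodr_gt0 => k kj.
  have -> : (x j - d - x k) * (x j + d - x k) = `|x j - x k| ^+ 2 - d ^+ 2.
    by rewrite real_normK ?num_real //; ring.
  rewrite subr_gt0 ltr_pXn2r ?nnegrE // ?(ltW d0) //.
  have := sep k j kj; rewrite distrC; lra.
have near_neg : \forall e \near (0 : R),
    forall j, (f.[x j - d] + e) * (f.[x j + d] + e) < 0.
  apply: (@filter_forall _ _
    (fun j e => (f.[x j - d] + e) * (f.[x j + d] + e) < 0) _
    (nbhs_filter (0 : R))) => j.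
  have : (fun e : R => (f.[x j - d] + e) * (f.[x j + d] + e)) @ 0 -->
      (f.[x j - d] + 0) * (f.[x j + d] + 0).
    by apply: cvgM; apply: cvgD;
      [exact: cvg_cst|exact: cvg_id|exact: cvg_cst|exact: cvg_id].
  by rewrite !addr0 => /cvgr_lt; apply.
near=> e.
have fe j : exists y, x j - d < y < x j + d /\ root (f + e%:P) y.
  have [||y yin ry] := @poly_ivtoo _ (f + e%:P) (x j - d) (x j + d).
  - lra.
  - by rewrite !hornerE; move: j; near: e.
  - by exists y; split => //; rewrite in_itv in yin.
have {fe}/choice[y yE] := fe.
exists y; split => [j|].
  by have [xd1 xd2] := xd j; have [/andP[? ?] _] := yE j; lra.
have sf : size f = m.+2.
  by rewrite /f size_prod_XsubC /index_enum -enumT size_enum_ord.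
have sfe : (size e%:P < size f)%N.
  by rewrite sf (leq_ltn_trans (size_polyC_leq1 _)).
have fm : lead_coef (f + e%:P) = 1.
  by rewrite lead_coefDl //; exact/monicP/monic_prod_XsubC.
have yinj : injective y.
  (* a common root would be within d of both x i and x j *)
  move=> i j yij; apply/eqP; apply: contraTT isT => ij.
  have [/andP[y1 y2] _] := yE i; have [/andP[y3 y4] _] := yE j.
  have := sep i j ij; rewrite yij in y1 y2.
  by case: (ger0P (x i - x j)) => h; lra.
have := @all_roots_prod_XsubC _ (f + e%:P) (map y (enum 'I_m.+1)).
rewrite fm scale1r big_map big_enum => <- //.
- by rewrite size_polyDl // size_map size_enum_ord.
- by apply/allP => _ /mapP[j _ ->]; have [] := yE j.
- by rewrite uniq_rootsE map_inj_uniq ?enum_uniq.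
Unshelve. all: by end_near.
Qed.

(** One coordinate is moved for each of the [r + 1] distinct values, even if
    the value is taken several times.  The sign comes from [prod_reciprocal]. *)
Lemma perturb_inner_values (R : realType) (I : finType) (p : I -> R) r
    (idx : 'I_r.+1 -> I) :
  (forall i, 0 <= p i <= 1) ->
  injective (p \o idx) -> (forall j, 0 < p (idx j) < 1) ->
  exists2 d : R, 0 < d & forall e : R, `|e| < d -> exists p' : I -> R,
    [/\ forall i, 0 <= p' i <= 1,
        forall Q : {poly R}, (size Q <= r.+1)%N -> \sum_i Q.[p' i] = \sum_i Q.[p i] &
        \prod_i (1 + p' i *: 'X) = \prod_i (1 + p i *: 'X) + ((-1) ^+ r.+1 * e) *:
          ('X^(r.+1) * \prod_(i | i \notin codom idx) (1 + p i *: 'X))].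
Proof.
move=> p01 pinj inner.
have idxinj : injective idx by move=> i j ij; apply: pinj; rewrite /= ij.
have /nbhs_ballP[d /= d0 dP] := perturbed_roots pinj inner.
exists d => // e ed; have [|y [y01 yE]] := dP e.
  by rewrite /ball /= sub0r normrN.
pose p' i := if [pick j | idx j == i] is Some j then y j else p i.
have p'idx j : p' (idx j) = y j.
  rewrite /p'; case: pickP => [k /eqP/idxinj -> //|/(_ j)].
  by rewrite eqxx.
have p'out i : i \notin codom idx -> p' i = p i.
  rewrite /p'; case: pickP => // k /eqP <-; by rewrite codom_f.
have split_op (V : Type) (z : V) (op : Monoid.com_law z) (F : I -> V) :
  \big[op/z]_i F i = op (\big[op/z]_j F (idx j)) (\big[op/z]_(i | i \notin codom idx) F i).
  rewrite (bigID (mem (codom idx))) /=; congr (op _ _).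
  rewrite -big_uniq /=; last by rewrite map_inj_uniq ?enum_uniq.
  by rewrite big_map big_enum.
exists p'; split.
- move=> i; rewrite /p'; case: pickP => // j _.
  by have /andP[? ?] := y01 j; rewrite !ltW.
- move=> Q sQ; rewrite !(split_op _ _ _ (fun i => Q.[_])); congr (_ + _).
    under eq_bigr do rewrite p'idx.
    exact: sum_horner_const_shift yE sQ.
  by apply: eq_bigr => i /p'out ->.
- rewrite !(split_op _ _ _ (fun i => 1 + _ *: 'X)).
  under eq_bigr do rewrite p'idx.
  rewrite (prod_reciprocal yE) /= mulrDl scalerAl; congr (_ * _ + _ * _).
    by apply: eq_bigr => i /p'out ->.
  by apply: eq_bigr => i /p'out ->.
Qed.

Lemma num_inner_gt (R : realType) (I : finType) (p : I -> R) r :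
  (forall i, 0 <= p i <= 1) -> (r < num_inner p)%N ->
  exists idx : 'I_r.+1 -> I, injective (p \o idx) /\ forall j, 0 < p (idx j) < 1.
Proof.
move=> p01 rp.
have fin : finite_set (inner_values p).
  apply: finite_setD; exact: finite_image.
set xs := fset_set (inner_values p) in rp.
have xsP (j : 'I_r.+1) : exists i, p i = nth 0 xs j /\ 0 < p i < 1.
  have jxs : (j < size xs)%N by apply: leq_trans rp.
  have := mem_nth 0 jxs; rewrite in_fset_set // inE => -[[i _ pi] n01].
  exists i; split => //; have /andP[p0 p1] := p01 i.
  rewrite !lt_neqAle p0 p1 !andbT; apply/andP; split; apply/eqP => h; apply: n01.
    by left; rewrite /= -pi -h.
  by right; rewrite /= -pi h.
have [idx idxP] := choice xsP.
exists idx; split => [i j /=|j]; last by have [] := idxP j.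
have [-> _] := idxP i; have [-> _] := idxP j.
move=> /eqP; rewrite nth_uniq ?fset_uniq //; last 2 first.
- exact: leq_trans rp.
- exact: leq_trans rp.
by move=> /eqP/val_inj.
Qed.

(** * Maximization over a compact set *)

(** The maximizers of [f] over [K] form again a compact set. *)
Lemma lex_max (R : realType) (T : topologicalType) (K : set T) (f h : T -> R) :
  compact K -> K !=set0 -> continuous f -> continuous h ->
  exists x, [/\ K x, forall y, K y -> f y <= f x &
    forall y, K y -> f y = f x -> h y <= h x].
Proof.
move=> cK K0 cf ch.
have [x /[!inE] Kx xmax] := compact_EVT_max K0 cK (continuous_subspaceT cf).
have cl : closed (f @^-1` [set f x]).
  by apply: preimage_closed => [y _|]; [exact: cf|exact: closed_eq].
have K'0 : (K `&` f @^-1` [set f x]) !=set0 by exists x.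
have [y /[!inE] -[Ky /= fyx] ymax] :=
  compact_EVT_max K'0 (compact_closedI cK cl) (continuous_subspaceT ch).
exists y; split => // [z Kz|z Kz fzy].
  by rewrite fyx xmax // inE.
by apply: ymax; rewrite inE; split => //=; rewrite fzy.
Qed.

Lemma continuous_sum (R : realType) (T : topologicalType) (J : Type) (s : seq J)
    (F : J -> T -> R) : (forall j, continuous (F j)) ->
  continuous (fun x => \sum_(j <- s) F j x).
Proof.
move=> cF; elim: s => [|j s IHs] x.
  rewrite (_ : (fun x => _) = fun=> 0); last by apply/funext => y; rewrite big_nil.
  exact: cvg_cst.
rewrite (_ : (fun x => _) = fun x => F j x + \sum_(k <- s) F k x); last first.
  by apply/funext => y; rewrite big_cons.
by apply: cvgD; [exact: cF|exact: IHs].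
Qed.

Lemma continuous_coef_prod (R : realType) (T : topologicalType) (J : Type) (s : seq J)
    (F : J -> T -> {poly R}) : (forall j k, continuous (fun x => (F j x)`_k)) ->
  forall k, continuous (fun x => (\prod_(j <- s) F j x)`_k).
Proof.
move=> cF; elim: s => [|j s IHs] k x.
  rewrite (_ : (fun x => _) = fun=> (1 : {poly R})`_k); last first.
    by apply/funext => y; rewrite big_nil.
  exact: cvg_cst.
rewrite (_ : (fun x => _) = fun x =>
    \sum_(i < k.+1) (F j x)`_i * (\prod_(l <- s) F l x)`_(k - i)); last first.
  by apply/funext => y; rewrite big_cons coefM.
apply: continuous_sum => i y; apply: cvgM; [exact: cF|exact: IHs].
Qed.

Lemma size_prod_affine (R : realType) (J : finType) (u v : J -> R) :
  (size (\prod_j ((u j)%:P + v j *: 'X))%R <= #|J|.+1)%N.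
Proof.
have -> : #|J| = \sum_(j : J) 1 by rewrite sum1_card.
elim/big_rec2: _ => [|j Q n _ IH]; first by rewrite size_poly1.
rewrite (leq_trans (size_polyMleq _ _)) //.
have h : (size ((u j)%:P + v j *: 'X)%R <= 2)%N.
  rewrite (leq_trans (size_polyD _ _)) // geq_max.
  rewrite (leq_trans (size_polyC_leq1 _)) //=.
  by rewrite (leq_trans (size_scale_leq _ _)) // size_polyX.
move: (size _) (size _) h IH => a b; lia.
Qed.

Lemma continuous_mulr_cst (R : realType) (T : topologicalType) (f : T -> R) (c : R) :
  continuous f -> continuous (fun x => f x * c).
Proof. by move=> cf x; apply: cvgM; [exact: cf|exact: cvg_cst]. Qed.

Section maximization.
Context {R : realType} {I : finType}.
Notation RI := (prod_topology (fun _ : I => R)).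

Lemma continuous_coef_prod_affine (u v : R -> R) k :
  continuous u -> continuous v ->
  continuous (fun p : RI => (\prod_i ((u (p i))%:P + v (p i) *: 'X))`_k).
Proof.
move=> cu cv; apply: continuous_coef_prod => i l.
have cp : continuous (fun p : RI => p i) by exact: proj_continuous.
rewrite (_ : (fun p : RI => _) = fun p : RI =>
    u (p i) * (l == 0%N)%:R + v (p i) * (l == 1%N)%:R); last first.
  apply/funext => p; rewrite coefD coefC coefZ coefX; case: (l == 0%N) => //=.
    by rewrite mulr1.
  by rewrite mulr0.
have cup : continuous (fun p : RI => u (p i)).
  by move=> p; exact: (continuous_comp (cp p) (cu _)).
have cvp : continuous (fun p : RI => v (p i)).
  by move=> p; exact: (continuous_comp (cp p) (cv _)).
move=> p.
exact: (cvgD (cvgM (cup p) (cvg_cst _)) (cvgM (cvp p) (cvg_cst _))).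
Qed.

Lemma continuous_expect_poly (phi : nat -> R) :
  continuous (fun p : RI => coef_pairing phi (\prod_i (1 + p i *: ('X - 1)))).
Proof.
have E (p : I -> R) : \prod_i (1 + p i *: ('X - 1)) =
    \prod_i ((1 - p i)%:P + p i *: 'X) :> {poly R}.
  by apply: eq_bigr => i _; rewrite scalerBr alg_polyC polyCB polyC1 addrA addrAC.
rewrite (_ : (fun p : RI => _) = fun p : RI => \sum_(k < #|I|.+1)
    (\prod_i ((1 - p i)%:P + p i *: 'X))`_k * phi k); last first.
  by apply/funext => p; rewrite E (coef_pairing_widen _ (size_prod_affine _ _)).
have cu : continuous (fun x : R => 1 - x).
  by move=> x; apply: cvgB; [exact: cvg_cst|exact: cvg_id].
have cid : continuous (fun x : R => x) by move=> x; exact: cvg_id.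
apply: continuous_sum => k; apply: continuous_mulr_cst.
exact: continuous_coef_prod_affine cu cid.
Qed.

(** In the cube the constraints are polynomial equations, by [cumulant_BC]. *)
Lemma feasible_compact r (c : 'I_r -> R) : compact (feasible c : set RI).
Proof.
pose S (j : 'I_r) (p : RI) := \sum_i (cumulant_poly (R := R) j).[p i].
have cS j : continuous (S j).
  apply: continuous_sum => i p.
  apply: (cvg_comp (fun q : RI => q i)); first exact: (@proj_continuous _ (fun _ => R)).
  exact: continuous_horner.
have -> : (feasible c : set RI) = [set p : RI | forall i, `[0, 1]%classic (p i)]
    `&` \bigcap_(j in [set: 'I_r]) (S j @^-1` [set c j]).
  apply/seteqP; split => p.
    move=> [p01 pc]; split => [i|j _ /=]; first by rewrite /= in_itv /= p01.
    by have := pc j; rewrite cumulant_BC // => /complexI.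
  move=> [p01' pc]; have p01 i : 0 <= p i <= 1.
    by have := p01' i; rewrite /= in_itv.
  split => // j; rewrite cumulant_BC //; congr (_%:C)%C; exact: pc.
apply: compact_closedI.
  by have := @tychonoff I (fun=> R) (fun=> `[0, 1]%classic) (fun=> @segment_compact R 0 1).
apply: closed_bigI => j _; apply: preimage_closed => [y _|]; first exact: cS.
exact: closed_eq.
Qed.

(** The point is chosen by maximizing first [G], the expectation of [g], and then
    [E], the elementary symmetric function of order [r + 1]: a perturbation of
    [r + 1] distinct inner values would increase one of them. *)
Lemma exists_maximizer_few_values (g : 'I_#|I|.+1 -> R) r (c : 'I_r -> R) :
  feasible (I := I) c !=set0 ->
  exists p : I -> R, maximizer c g p /\ (num_inner p <= r)%N.
Proof.
move=> D0; pose phi k := extend0 g (k%:R : R).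
pose G (p : RI) := coef_pairing phi (\prod_i (1 + p i *: ('X - 1))).
pose E (p : RI) := (\prod_i (1 + p i *: 'X))`_r.+1.
have cE : continuous E.
  apply: (continuous_coef_prod_affine (u := fun=> 1) (v := id)).
    by move=> x; exact: cvg_cst.
  by move=> x; exact: cvg_id.
have [p [pD pG pE]] := lex_max (feasible_compact (c := c)) D0
  (continuous_expect_poly (phi := phi)) cE.
have [p01 pc] := pD.
exists p; split.
  split => // p' p'D; rewrite !expect_BC //; [exact: pG|by case: p'D].
rewrite leqNgt; apply/negP => /(num_inner_gt p01)[idx [pinj inner]].
have [d d0 dP] := perturb_inner_values p01 pinj inner.
set C : {poly R} := 'X^(r.+1) * \prod_(i | i \notin codom idx) (1 + p i *: 'X) in dP.
pose a := coef_pairing phi (C \Po ('X - 1)).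
have C1 : C`_r.+1 = 1.
  rewrite coefXnM ltnn subnn -horner_coef0 horner_prod big1 // => i _.
  by rewrite !hornerE.
(* both functions are affine along the perturbation; the sign of
   perturb_inner_values is absorbed in e *)
have step e : `|e| < d -> exists p' : RI, [/\ feasible c p',
    G p' = G p + e * a & E p' = E p + e].
  move=> ed; have [|p' [p'01 p'S p'P]] := dP ((-1) ^+ r.+1 * e).
    by rewrite normrM normrX normrN1 expr1n mul1r.
  have {}p'P : \prod_i (1 + p' i *: 'X) = \prod_i (1 + p i *: 'X) + e *: C.
    by rewrite p'P mulrA -exprMn mulrNN mulr1 expr1n mul1r.
  exists p'; split.
  - split=> [|j]; first exact: p'01.
    rewrite (cumulant_BC _ p'01) p'S; last first.
      by rewrite (leq_trans (size_cumulant_poly _)) // ltnS.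
    by rewrite -(cumulant_BC _ p01); exact: pc.
  - rewrite /G !prod_comp_XsubC1 p'P comp_polyD comp_polyZ.
    by rewrite raddfD /= linearZ.
  - by rewrite /E p'P coefD coefZ C1 mulr1.
have d2 : `|d / 2| < d by rewrite gtr0_norm ?divr_gt0 //; lra.
have [a0|a0] := eqVneq a 0.
  have [p' [p'D]] := step _ d2; rewrite a0 mulr0 addr0 => /(pE _ p'D) + h.
  by rewrite h; lra.
have [|p' [p'D p'G _]] := step (d / 2 * Num.sg a).
  by rewrite normrM normr_sg a0 mulr1.
have := pG _ p'D; rewrite -/(G p') -/(G p) p'G => h.
have ea : d / 2 * Num.sg a * a = d / 2 * `|a| by rewrite [in RHS]normrEsg mulrA.
have : 0 < d / 2 * `|a| by rewrite mulr_gt0 ?normr_gt0 ?divr_gt0.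
rewrite ea in h; lra.
Qed.

End maximization.

Theorem theorem1p1 (R : realType) (I : finType) (g : 'I_#|I|.+1 -> R)
    (r : nat) (c : 'I_r -> R) (hD : feasible (I := I) c !=set0) :
  (exists p : I -> R, maximizer c g p /\ (num_inner p <= r)%N) /\
  (forall p : I -> R, maximizer c g p -> (num_inner p <= r)%N ->
   forall q : nat -> R,
     q 0%N = 1 ->
     set_bij [set j | (1 <= j <= num_inner p)%N] (inner_values p) q ->
   forall A : set (measurableTypeR R), measurable A ->
     BC p A =
     convolution (delta (multiplicity p (q 0%N))%:R)
       (\big[convolution/delta 0]_(1 <= j < (num_inner p).+1)
          binomialR (multiplicity p (q j)) (q j)) A).
Proof.
split; first exact: exists_maximizer_few_values.
move=> p [[p01 _] _] _ q q0 qbij A mA; rewrite q0.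
exact: BC_binomial_decomposition.
Qed.
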